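(* Let $\varepsilon^i=\pm1$, $i=1,2$, let $b^1(u),b^2(u)$ be nonzero functions of $u=(u^1,u^2)$, and let $f^1(u^1)$, $f^2(u^2)$ be nonzero functions of the indicated single variables. The two-component metrics $$(g_2^{ij}(u))=\begin{pmatrix}\dfrac{\varepsilon^1}{(b^1(u))^2}&0\\0&\dfrac{\varepsilon^2}{(b^2(u))^2}\end{pmatrix},\qquad (g_1^{ij}(u))=\begin{pmatrix}\dfrac{\varepsilon^1f^1(u^1)}{(b^1(u))^2}&0\\0&\dfrac{\varepsilon^2f^2(u^2)}{(b^2(u))^2}\end{pmatrix}$$ form a flat pencil of metrics if and only if the functions $b^i(u)$, $i=1,2$, are solutions of the linear system $$\frac{\partial b^2}{\partial u^1}=\varepsilon^1\frac{\partial F}{\partial u^2}\,b^1(u),\qquad \frac{\partial b^1}{\partial u^2}=-\varepsilon^2\frac{\partial F}{\partial u^1}\,b^2(u),$$ where the function $F(u)$ is a solution of the linear equation $$2\frac{\partial^2F}{\partial u^1\partial u^2}\bigl(f^1(u^1)-f^2(u^2)\bigr)+\frac{\partial F}{\partial u^2}\frac{df^1(u^1)}{du^1}-\frac{\partial F}{\partial u^1}\frac{df^2(u^2)}{du^2}=0.$$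
   Context: Everything is local and smooth. Metrics are contravariant (upper indices), $g_{ij}$ denotes the inverse of $g^{ij}$; $\Gamma^i_{jk}$ are the Levi--Civita connection coefficients of a metric and $\Gamma^{ij}_k=g^{is}\Gamma^j_{sk}$. The subscripts $1,2$ on $\Gamma$ refer to $g_1^{ij}$, $g_2^{ij}$. Two metrics $g_1^{ij}$, $g_2^{ij}$ form a flat pencil of metrics if both are flat and for all constants $\lambda_1,\lambda_2$ such that $\det(\lambda_1g_1^{ij}+\lambda_2g_2^{ij})\not\equiv0$ the metric $g^{ij}=\lambda_1g_1^{ij}+\lambda_2g_2^{ij}$ is flat and its Levi--Civita connection satisfies $\Gamma^{ij}_k=\lambda_1\Gamma^{ij}_{1,k}+\lambda_2\Gamma^{ij}_{2,k}$. The condition on the $b^i$ means that there exists a function $F(u)$ solving the displayed linear equation for which $(b^1,b^2)$ solves the displayed linear system. *)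

(* Defs.v *)
From mathcomp Require Import all_boot all_order all_algebra.
From mathcomp Require Import all_classical all_reals all_analysis.

Set Implicit Arguments.
Unset Strict Implicit.
Unset Printing Implicit Defensive.

Import Order.TTheory GRing.Theory Num.Theory.
Import numFieldNormedType.Exports.

Local Open Scope classical_set_scope.
Local Open Scope ring_scope.

(* A point u of R^n is a row vector; its coordinate u^i is u 0 i. *)

Definition pd (R : realType) (n : nat) (i : 'I_n) (h : 'rV[R]_n -> R) :
    'rV[R]_n -> R :=
  fun u => 'D_(delta_mx 0 i) h u.

(* h is of class C^k on U, which is meant to be open: all partial derivatives
   of order at most k exist and are continuous at every point of U. *)
Fixpoint Ck_on (R : realType) (n : nat) (k : nat) (U : set 'rV[R]_n)
    (h : 'rV[R]_n -> R) : Prop :=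
  (forall u, U u -> {for u, continuous h}) /\
  (if k is k'.+1 then
     forall i : 'I_n,
       (forall u, U u -> derivable h u (delta_mx 0 i)) /\ Ck_on k' U (pd i h)
   else True).

Definition smooth_on (R : realType) (n : nat) (U : set 'rV[R]_n)
    (h : 'rV[R]_n -> R) : Prop :=
  forall k, Ck_on k U h.

Definition smooth1_on (R : realType) (I : set R) (h : R -> R) : Prop :=
  forall (k : nat) (x : R), I x -> derivable (derive1n k h) x 1.

(* The open box I_1 x ... x I_n. *)
Definition box (R : realType) (n : nat) (I : 'I_n -> set R) : set 'rV[R]_n :=
  [set u | forall i, I i (u 0 i)].

(* Metrics are contravariant: g u i j is g^{ij}(u), and g_{ij}(u) is
   invmx (g u) i j. *)
Definition is_metric_on (R : realType) (n : nat) (U : set 'rV[R]_n)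
    (g : 'rV[R]_n -> 'M[R]_n) : Prop :=
  (forall i j, smooth_on U (fun u => g u i j)) /\
  (forall u, U u -> (g u)^T = g u /\ \det (g u) != 0).

Definition cov (R : realType) (n : nat) (g : 'rV[R]_n -> 'M[R]_n)
    (i j : 'I_n) : 'rV[R]_n -> R :=
  fun u => invmx (g u) i j.

(* christoffel g i j k is Gamma^i_{jk}. *)
Definition christoffel (R : realType) (n : nat) (g : 'rV[R]_n -> 'M[R]_n)
    (i j k : 'I_n) : 'rV[R]_n -> R :=
  fun u => 2^-1 * \sum_(s < n) g u i s *
    (pd j (cov g s k) u + pd k (cov g s j) u - pd s (cov g j k) u).

(* contra_christoffel g i j k is
   Gamma^{ij}_k = g^{is} Gamma^j_{sk}. *)
Definition contra_christoffel (R : realType) (n : nat)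
    (g : 'rV[R]_n -> 'M[R]_n) (i j k : 'I_n) : 'rV[R]_n -> R :=
  fun u => \sum_(s < n) g u i s * christoffel g j s k u.

(* riemann g i j k l is R^i_{jkl} = d_k Gamma^i_{lj} - d_l Gamma^i_{kj}
   + Gamma^i_{kp} Gamma^p_{lj} - Gamma^i_{lp} Gamma^p_{kj}. *)
Definition riemann (R : realType) (n : nat) (g : 'rV[R]_n -> 'M[R]_n)
    (i j k l : 'I_n) : 'rV[R]_n -> R :=
  fun u =>
    pd k (christoffel g i l j) u - pd l (christoffel g i k j) u
    + \sum_(p < n) (christoffel g i k p u * christoffel g p l j u
                    - christoffel g i l p u * christoffel g p k j u).

Definition flat_metric_on (R : realType) (n : nat) (U : set 'rV[R]_n)
    (g : 'rV[R]_n -> 'M[R]_n) : Prop :=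
  is_metric_on U g /\
  (forall i j k l u, U u -> riemann g i j k l u = 0).

Definition pencil (R : realType) (n : nat) (g1 g2 : 'rV[R]_n -> 'M[R]_n)
    (l1 l2 : R) : 'rV[R]_n -> 'M[R]_n :=
  fun u => l1 *: g1 u + l2 *: g2 u.

(* If the determinant of l1 g1 + l2 g2 is not identically zero on U, it may
   still vanish at some points of U; the combination is a metric, and is
   required to be flat, on the open subset where it is nondegenerate. *)
Definition flat_pencil_on (R : realType) (n : nat) (U : set 'rV[R]_n)
    (g1 g2 : 'rV[R]_n -> 'M[R]_n) : Prop :=
  [/\ flat_metric_on U g1,
      flat_metric_on U g2 &
      forall l1 l2 : R,
        (exists u, U u /\ \det (pencil g1 g2 l1 l2 u) != 0) ->
        let V := [set u | U u /\ \det (pencil g1 g2 l1 l2 u) != 0] in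
        flat_metric_on V (pencil g1 g2 l1 l2) /\
        (forall i j k u, V u ->
           contra_christoffel (pencil g1 g2 l1 l2) i j k u =
           l1 * contra_christoffel g1 i j k u
           + l2 * contra_christoffel g2 i j k u)].

(* Zero-based encodings of the index values 1 and 2. *)
Notation i1 := (@ord0 1).
Notation i2 := (@ord_max 1).

(* Main.v *)
Require Import Defs.
From mathcomp Require Import all_boot all_order all_algebra.
From mathcomp Require Import all_classical all_reals all_analysis.
From mathcomp Require Import ring lra.

(** Both metrics, and every combination l1 g1 + l2 g2, are diagonal with
    contravariant entries eps_i phi_i(u^i) / (b^i)^2, where phi_i is f^i, 1 and
    l1 f^i + l2 respectively. Let beta_ij = (d_i b^j) / b^i, with d_i the
    partial derivative in u^i. In dimension two the curvature of such a metric
    vanishes if and only if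
      eps_1 (phi_1 d_1 beta_12 + phi_1' beta_12 / 2)
      + eps_2 (phi_2 d_2 beta_21 + phi_2' beta_21 / 2) = 0,
    which is linear in phi ([flat_metric_diag]). Its contravariant Christoffel
    symbols are linear in phi as well ([contra_christoffel_linear]). Hence the
    compatibility of the connections is automatic and flatness of the whole
    pencil follows from flatness of g1 and g2 ([flat_pencil_diag]).

    For g2 the condition reads eps_1 d_1 beta_12 + eps_2 d_2 beta_21 = 0: the
    form - eps_2 beta_21 du^1 + eps_1 beta_12 du^2 is closed. On a box it has
    a potential F ([poincare]), and the equations d_1 F = - eps_2 beta_21 and
    d_2 F = eps_1 beta_12 are the linear system for b^1 and b^2. Twice the
    condition for g1 minus 2 f^2 times the condition for g2 is then the linear
    equation for F. Conversely, the linear system determines beta from F; the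
    condition for g2 becomes the symmetry of the mixed derivatives of F
    ([pd_comm]), and with it the equation for F gives back the condition
    for g1. *)

Set Implicit Arguments.
Unset Strict Implicit.
Unset Printing Implicit Defensive.

Import Order.TTheory GRing.Theory Num.Theory.
Import numFieldNormedType.Exports.

Local Open Scope classical_set_scope.
Local Open Scope ring_scope.

(** * Partial derivatives and functions of class C^k *)

Section PartialDerivatives.
Context {R : realType} {n : nat}.
Implicit Types (U V : set 'rV[R]_n) (g h : 'rV[R]_n -> R) (i j : 'I_n).

(** Existence and value of a partial derivative in one statement, so that the
    rules of calculus below compose without separate derivability goals. *)
Definition is_pd i (h : 'rV[R]_n -> R) (u : 'rV[R]_n) (d : R) : Prop :=
  is_derive u (delta_mx 0 i : 'rV[R]_n) h d.

Lemma is_pd_val i h u d : is_pd i h u d -> pd i h u = d.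
Proof. by case. Qed.

Lemma is_pd_eq i h u d d' : is_pd i h u d -> d = d' -> is_pd i h u d'.
Proof. by move=> + <-. Qed.

Lemma is_pd_derivable i h u d : is_pd i h u d -> derivable h u (delta_mx 0 i).
Proof. by case. Qed.

Lemma is_pd_pd i h u : derivable h u (delta_mx 0 i) -> is_pd i h u (pd i h u).
Proof. exact: derivableP. Qed.

Lemma is_pd_cst i (c : R) u : is_pd i (fun=> c) u 0.
Proof. exact: is_derive_cst. Qed.

Lemma is_pdD i g h u dg dh : is_pd i g u dg -> is_pd i h u dh ->
  is_pd i (fun v => g v + h v) u (dg + dh).
Proof. exact: is_deriveD. Qed.

Lemma is_pdM i g h u dg dh : is_pd i g u dg -> is_pd i h u dh ->
  is_pd i (fun v => g v * h v) u (dg * h u + g u * dh).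
Proof.
move=> gd hd; apply: is_derive_eq (is_deriveM gd hd) _.
by rewrite /GRing.scale /=; ring.
Qed.

Lemma is_pdN i h u d : is_pd i h u d -> is_pd i (fun v => - h v) u (- d).
Proof. exact: is_deriveN. Qed.

Lemma is_pdV i h u d : h u != 0 -> is_pd i h u d ->
  is_pd i (fun v => (h v)^-1) u (- d / h u ^+ 2).
Proof.
move=> h0 [hd <-]; apply: DeriveDef; first exact: derivableV.
by rewrite deriveV// /GRing.scale /=; ring.
Qed.

Lemma is_pd_div i g h u dg dh : h u != 0 ->
  is_pd i g u dg -> is_pd i h u dh ->
  is_pd i (fun v => g v / h v) u ((dg * h u - g u * dh) / h u ^+ 2).
Proof.
move=> h0 gd hd; have := is_pdM gd (is_pdV h0 hd); congr is_pd.
by field.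
Qed.

Lemma pd_near i g h u : (\near u, g u = h u) -> pd i g u = pd i h u.
Proof. exact: near_eq_derive. Qed.

Lemma open_near U (P : 'rV[R]_n -> Prop) : open U ->
  (forall v, U v -> P v) -> forall u, U u -> \forall v \near u, P v.
Proof. by move=> Uo UP u Uu; apply: filterS UP _; exact: open_nbhs_nbhs. Qed.

Lemma pd_open i U g h : open U -> (forall v, U v -> g v = h v) ->
  forall u, U u -> pd i g u = pd i h u.
Proof. by move=> Uo gh u Uu; apply: pd_near; exact: (open_near Uo gh Uu). Qed.

Lemma continuous_near g h u : (\near u, g u = h u) ->
  {for u, continuous g} -> {for u, continuous h}.
Proof.
move=> gh; rewrite /prop_for /continuous_at -(nbhs_singleton gh).
by apply: cvg_trans; apply: (@near_eq_cvg _ _ (nbhs u)).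
Qed.

(** Because U is open, partial derivatives only depend on the values on U;
    this lets a derivative computed on U stand in for the formal one when the
    order of differentiability is raised by induction. *)
Lemma Ck_eq k U g h : open U -> (forall u, U u -> g u = h u) ->
  Ck_on k U g -> Ck_on k U h.
Proof.
move=> Uo; elim: k g h => [|k IH] g h gh /= [gc gd]; split.
- by move=> u Uu; exact: continuous_near (open_near Uo gh Uu) (gc u Uu).
- by [].
- by move=> u Uu; exact: continuous_near (open_near Uo gh Uu) (gc u Uu).
- move=> i; have [gdi gpi] := gd i; split.
    move=> u Uu; apply: near_eq_derivable (gdi _ Uu); exact: (open_near Uo gh Uu).
  by apply: IH gpi => u; exact: pd_open.
Qed.

Lemma Ck_cont k U h u : Ck_on k U h -> U u -> {for u, continuous h}.
Proof. by case: k => [|k] /= [hc _]; exact: hc. Qed.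

Lemma CkW k U h : Ck_on k.+1 U h -> Ck_on k U h.
Proof.
elim: k h => [|k IH] h [hc hd]; split => // i.
by have [hdi /IH hpi] := hd i; split.
Qed.

Lemma Ck_sub k U V h : V `<=` U -> Ck_on k U h -> Ck_on k V h.
Proof.
move=> VU; elim: k h => [|k IH] h /= [hc hd].
all: split; first by move=> u Vu; apply: hc; exact: VU.
  by [].
by move=> i; have [hdi hpi] := hd i; split; [move=> u /VU; exact: hdi|exact: IH].
Qed.

Lemma Ck_cst k U (c : R) : open U -> Ck_on k U (fun=> c).
Proof.
move=> Uo; elim: k c => [|k IH] c.
all: split; first by move=> u _; exact: cst_continuous.
  by [].
move=> i; split; first by move=> u _; exact: is_pd_derivable (is_pd_cst _ _ _).
apply: Ck_eq (IH 0) => // u _; exact/esym/is_pd_val/is_pd_cst.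
Qed.

Lemma CkD k U g h : open U -> Ck_on k U g -> Ck_on k U h ->
  Ck_on k U (fun u => g u + h u).
Proof.
move=> Uo; elim: k g h => [|k IH] g h [gc gd] [hc hd].
all: have c u : U u -> {for u, continuous (fun u => g u + h u)}.
1,3: by move=> Uu; apply: continuousD; [exact: gc|exact: hc].
all: split=> // i; have [gi gk] := gd i; have [hi hk] := hd i.
have is_pdi u : U u -> is_pd i (fun u => g u + h u) u (pd i g u + pd i h u).
  by move=> Uu; apply: is_pdD; apply: is_pd_pd; [exact: gi|exact: hi].
split; first by move=> u /is_pdi /is_pd_derivable.
by apply: Ck_eq (IH _ _ gk hk) => // u /is_pdi /is_pd_val.
Qed.

Lemma CkM k U g h : open U -> Ck_on k U g -> Ck_on k U h ->
  Ck_on k U (fun u => g u * h u).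
Proof.
move=> Uo; elim: k g h => [|k IH] g h gk1 hk1.
all: have c u : U u -> {for u, continuous (fun u => g u * h u)}.
1,3: by move=> Uu; apply: continuousM; [exact: Ck_cont gk1 Uu|exact: Ck_cont hk1 Uu].
all: split=> // i; have [gi gk] := gk1.2 i; have [hi hk] := hk1.2 i.
have is_pdi u : U u ->
    is_pd i (fun u => g u * h u) u (pd i g u * h u + g u * pd i h u).
  by move=> Uu; apply: is_pdM; apply: is_pd_pd; [exact: gi|exact: hi].
split; first by move=> u /is_pdi /is_pd_derivable.
apply: (@Ck_eq _ _ (fun u => pd i g u * h u + g u * pd i h u)) => //.
  by move=> u /is_pdi /is_pd_val.
by apply: CkD => //; apply: IH => //; exact: CkW.
Qed.

Lemma CkV k U h : open U -> (forall u, U u -> h u != 0) -> Ck_on k U h ->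
  Ck_on k U (fun u => (h u)^-1).
Proof.
move=> Uo h0; elim: k h h0 => [|k IH] h h0 hk1.
all: have c u : U u -> {for u, continuous (fun u => (h u)^-1)}.
1,3: by move=> Uu; apply: continuousV; [exact: h0|exact: Ck_cont hk1 Uu].
all: split=> // i; have [hi hk] := hk1.2 i.
have is_pdi u : U u -> is_pd i (fun u => (h u)^-1) u (- pd i h u / h u ^+ 2).
  by move=> Uu; apply: is_pdV; [exact: h0|apply: is_pd_pd; exact: hi].
split; first by move=> u /is_pdi /is_pd_derivable.
apply: (@Ck_eq _ _ (fun u => (-1 * pd i h u) * ((h u)^-1 * (h u)^-1))) => //.
  by move=> u /is_pdi /is_pd_val ->; rewrite -invfM; ring.
have hVk := IH _ h0 (CkW hk1).
by apply: CkM => //; apply: CkM => //; exact: Ck_cst.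
Qed.

(** The difference quotient is constantly zero. *)
Lemma is_pd_coord_neq i j (phi : R -> R) (u : 'rV[R]_n) : i != j ->
  is_pd i (fun v => phi (v 0 j)) u 0.
Proof.
move=> ij; have e : (fun h : R => h^-1 *: (((fun v : 'rV[R]_n => phi (v 0 j))
    \o shift u) (h *: delta_mx 0 i) - phi (u 0 j))) = cst 0.
  apply/funext => h /=; rewrite !mxE eqxx eq_sym (negbTE ij).
  by rewrite mulr0 add0r subrr scaler0.
by apply: DeriveDef; rewrite /derivable /derive e; [exact: is_cvg_cst|exact: lim_cst].
Qed.

Lemma is_pd_coord i (phi : R -> R) (u : 'rV[R]_n) : derivable phi (u 0 i) 1 ->
  is_pd i (fun v => phi (v 0 i)) u (derive1 phi (u 0 i)).
Proof.
move=> phid; have e : (fun h : R => h^-1 *: (((fun v : 'rV[R]_n => phi (v 0 i))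
    \o shift u) (h *: delta_mx 0 i) - phi (u 0 i))) =
  (fun h : R => h^-1 *: ((phi \o shift (u 0 i)) (h *: 1) - phi (u 0 i))).
  by apply/funext => h /=; rewrite !mxE !eqxx.
apply: DeriveDef; first by move: phid; rewrite /derivable e.
by rewrite /derive e derive1E.
Qed.

Lemma Ck_coord k U j (J : set R) (phi : R -> R) : open U ->
  (forall u, U u -> J (u 0 j)) -> smooth1_on J phi ->
  Ck_on k U (fun u => phi (u 0 j)).
Proof.
move=> Uo UJ; elim: k phi => [|k IH] phi phis.
all: have c u : U u -> {for u, continuous (fun u : 'rV[R]_n => phi (u 0 j))}.
1,3: move=> /UJ Ju; apply: continuous_comp; first exact: coord_continuous.
1,2: by apply/differentiable_continuous/derivable1_diffP; exact: (phis 0).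
all: split=> // i.
have is_pdi u : U u ->
    is_pd i (fun v => phi (v 0 j)) u ((i == j)%:R * derive1 phi (u 0 j)).
  move=> /UJ Ju; have [->|ij] := eqVneq i j; last first.
    by rewrite mul0r; exact: is_pd_coord_neq.
  by rewrite mul1r; apply: is_pd_coord; exact: (phis 0).
split; first by move=> u /is_pdi /is_pd_derivable.
apply: (@Ck_eq _ _ (fun u => (i == j)%:R * derive1 phi (u 0 j))) => //.
  by move=> u /is_pdi /is_pd_val.
apply: CkM => //; first exact: Ck_cst.
apply: IH => m x Jx; rewrite -derive1Sn; exact: phis.
Qed.

Lemma smooth_pd U i h : smooth_on U h -> smooth_on U (pd i h).
Proof. by move=> hs k; have [_ /(_ i)[]] := hs k.+1. Qed.

Lemma smooth_is_pd U i h u : smooth_on U h -> U u -> is_pd i h u (pd i h u).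
Proof. by move=> hs Uu; apply: is_pd_pd; have [_ /(_ i)[+ _]] := hs 1; apply. Qed.

Lemma smooth_cont U h u : smooth_on U h -> U u -> {for u, continuous h}.
Proof. by move=> hs; exact: Ck_cont (hs 0). Qed.

Lemma pdZ U (c : R) h i u : smooth_on U h -> U u ->
  pd i (fun v => c * h v) u = c * pd i h u.
Proof.
move=> hs Uu; apply: is_pd_val.
apply: is_pd_eq (is_pdM (is_pd_cst i c u) (smooth_is_pd i hs Uu)) _.
by rewrite mul0r add0r.
Qed.

Lemma smoothZ U (c : R) h : open U -> smooth_on U h ->
  smooth_on U (fun v => c * h v).
Proof. by move=> Uo hs k; apply: CkM => //; exact: Ck_cst. Qed.

End PartialDerivatives.

(** * Points and slices of the plane *)

Section Plane.
Context {R : realType}.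
Implicit Types (x y s t : R) (h : 'rV[R]_2 -> R) (u : 'rV[R]_2).

Definition pt x y : 'rV[R]_2 := \row_j (if j == i1 then x else y).

Lemma pt1 x y : pt x y 0 i1 = x. Proof. by rewrite mxE. Qed.

Lemma pt2 x y : pt x y 0 i2 = y. Proof. by rewrite mxE. Qed.

Lemma I2_case (j : 'I_2) : j = i1 \/ j = i2.
Proof. by case: j => -[|[|]]// ?; [left|right]; exact/val_inj. Qed.

Lemma pt_eta u : pt (u 0 i1) (u 0 i2) = u.
Proof. by apply/rowP => j; rewrite mxE; case: (I2_case j) => ->. Qed.

Lemma box_pt (J : 'I_2 -> set R) x y : box J (pt x y) <-> J i1 x /\ J i2 y.
Proof.
split=> [b|[Jx Jy] j]; first by have := (b i1, b i2); rewrite pt1 pt2 => -[].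
by case: (I2_case j) => ->; rewrite ?pt1 ?pt2.
Qed.

Lemma open_box n (J : 'I_n -> set R) : (forall i, open (J i)) -> open (box J).
Proof.
move=> Jo; rewrite openE => u Ju /=; rewrite /interior.
suff : \forall v \near (u : 'rV[R]_n), forall i, J i ((v : 'rV[R]_n) 0 i) by [].
apply: (@filter_forall _ _ (fun i v => J i ((v : 'rV[R]_n) 0 i)) (nbhs u)) => i.
by apply: coord_continuous; apply: open_nbhs_nbhs; split; [exact: Jo|exact: Ju].
Qed.

(** Neighbourhoods of a row vector are those of the product topology, which
    [near_pt] and [near_unpt] express in both directions. *)
Lemma near_pt x y (P : 'rV[R]_2 -> Prop) :
  (\forall u \near pt x y, P u) -> \forall s \near x & t \near y, P (pt s t).
Proof.
move=> /nbhs_ballP[e /= e0 eP].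
near=> s t; apply: eP; split=> // i j; rewrite !mxE.
by case: ifP => _; [near: s|near: t]; exact: nbhsx_ballx.
Unshelve. all: by end_near. Qed.

Lemma near_unpt u (P : R -> R -> Prop) :
  (\forall s \near u 0 i1 & t \near u 0 i2, P s t) ->
  \forall v \near u, P ((v : 'rV[R]_2) 0 i1) ((v : 'rV[R]_2) 0 i2).
Proof.
move=> [[A B] /= [Au Bu] AB].
have nA : \forall v \near u, A ((v : 'rV[R]_2) 0 i1) by exact: coord_continuous Au.
have nB : \forall v \near u, B ((v : 'rV[R]_2) 0 i2) by exact: coord_continuous Bu.
by near=> v; apply: (AB (_, _)); split=> /=; near: v.
Unshelve. all: by end_near. Qed.

(** A partial derivative is the derivative of a one-variable slice, so that the
    one-variable mean value theorem applies to it. *)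
Lemma is_pd_pt1 h x y d :
  is_pd i1 h (pt x y) d <-> is_derive x 1 (fun s => h (pt s y)) d.
Proof.
rewrite /is_pd; suff e : (fun t => t^-1 *: ((h \o shift (pt x y)) (t *: delta_mx 0 i1)
    - h (pt x y))) =
   (fun t => t^-1 *: (((fun s => h (pt s y)) \o shift x) (t *: 1) - h (pt x y))).
  by split=> -[] hd hv; (apply: DeriveDef; first by move: hd; rewrite /derivable e);
    rewrite -hv /derive e.
apply/funext => t /=; congr (_ *: (h _ - _)).
by apply/rowP => j; rewrite !mxE eqxx; case: (I2_case j) => -> /=;
  rewrite /GRing.scale /= ?mulr1 ?mulr0 ?add0r.
Qed.

Lemma is_pd_pt2 h x y d :
  is_pd i2 h (pt x y) d <-> is_derive y 1 (fun t => h (pt x t)) d.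
Proof.
rewrite /is_pd; suff e : (fun t => t^-1 *: ((h \o shift (pt x y)) (t *: delta_mx 0 i2)
    - h (pt x y))) =
   (fun t => t^-1 *: (((fun s => h (pt x s)) \o shift y) (t *: 1) - h (pt x y))).
  by split=> -[] hd hv; (apply: DeriveDef; first by move: hd; rewrite /derivable e);
    rewrite -hv /derive e.
apply/funext => t /=; congr (_ *: (h _ - _)).
by apply/rowP => j; rewrite !mxE eqxx; case: (I2_case j) => -> /=;
  rewrite /GRing.scale /= ?mulr1 ?mulr0 ?add0r.
Qed.

End Plane.

(** * Symmetry of mixed partial derivatives *)

Section SecondDifference.
Context {R : realType}.
Implicit Types (x y s t e c : R).

Lemma mvt (f df : R -> R) a b : a < b ->
  (forall x, a <= x <= b -> is_derive x 1 f (df x)) ->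
  exists2 c, a < c < b & f b - f a = df c * (b - a).
Proof.
move=> ab fd; have [|x xab|c cab fc] := @MVT R f df a b ab.
- by move=> x; rewrite in_itv /= => /andP[ax xb]; apply: fd; rewrite !ltW.
- apply: derivable_within_continuous => // z; rewrite in_itv /= => zab.
  by have [] := fd z zab.
- by exists c.
Qed.

(** The mean value theorem, applied first to the difference of phi along y as
    a function of x, then to phi1 as a function of y. *)
Lemma second_difference (phi phi1 phi12 : R -> R -> R) x y s : 0 < s ->
  (forall x' y', x <= x' <= x + s -> y <= y' <= y + s ->
     is_derive x' 1 (phi^~ y') (phi1 x' y') /\
     is_derive y' 1 (phi1 x') (phi12 x' y')) ->
  exists c : R * R, [/\ x < c.1 < x + s, y < c.2 < y + s &
    phi (x + s) (y + s) - phi (x + s) y - (phi x (y + s) - phi x y)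
    = phi12 c.1 c.2 * s * s].
Proof.
move=> s0 phid; have lt z : z < z + s by rewrite ltrDl.
have [c1 c1x E1] : exists2 c, x < c < x + s &
    (phi (x + s) (y + s) - phi (x + s) y) - (phi x (y + s) - phi x y)
    = (phi1 c (y + s) - phi1 c y) * (x + s - x).
  apply: (@mvt (fun z => phi z (y + s) - phi z y)
               (fun z => phi1 z (y + s) - phi1 z y)) => // z zx.
  by apply: is_deriveB; apply phid; rewrite ?lexx ?(ltW (lt _)).
have [c2 c2y E2] : exists2 c, y < c < y + s &
    phi1 c1 (y + s) - phi1 c1 y = phi12 c1 c * (y + s - y).
  apply: mvt => // z zy; apply phid => //.
  by move/andP: c1x => [a b]; rewrite !ltW.
by exists (c1, c2); split => //=; rewrite E1 E2; ring.
Qed.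

Lemma close_eq (a b c d e : R) : c = d ->
  `|a - c| < e / 2 -> `|b - d| < e / 2 -> `|b - a| <= e.
Proof. by move=> ->; rewrite !ltr_norml ler_norml => H1 H2; lra. Qed.

(** Schwarz's theorem: the second difference of h over a small square of side
    s is s^2 times either mixed derivative at some point of the square, and
    both are continuous at the corner u. *)
Lemma pd_comm (U : set 'rV[R]_2) h : open U -> smooth_on U h ->
  forall u, U u -> pd i1 (pd i2 h) u = pd i2 (pd i1 h) u.
Proof.
move=> Uo hs u Uu; apply/eqP; rewrite -subr_eq0 -normr_le0.
apply/ler_addgt0Pr => e e0; rewrite add0r.
have c12 := smooth_cont (smooth_pd i2 (smooth_pd i1 hs)) Uu.
have c21 := smooth_cont (smooth_pd i1 (smooth_pd i2 hs)) Uu.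
have e20 : 0 < e / 2 by rewrite divr_gt0.
have : \forall v \near u, [/\ U v,
    `|pd i2 (pd i1 h) u - pd i2 (pd i1 h) v| < e / 2 &
    `|pd i1 (pd i2 h) u - pd i1 (pd i2 h) v| < e / 2].
  have nU : \forall v \near u, U v by exact: (open_near Uo _ Uu).
  have n12 : \forall v \near u, `|pd i2 (pd i1 h) u - pd i2 (pd i1 h) v| < e / 2
    by move/cvgrPdist_lt : c12; apply.
  have n21 : \forall v \near u, `|pd i1 (pd i2 h) u - pd i1 (pd i2 h) v| < e / 2
    by move/cvgrPdist_lt : c21; apply.
  by apply: filterS3 nU n12 n21 => v; split.
rewrite -{1}(pt_eta u); move: (u 0 i1) (u 0 i2) => x y.
move=> /near_pt [[A B] /= [/nbhs_ballP[a a0 aA] /nbhs_ballP[b b0 bB]] AB].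
pose s := Num.min a b / 2.
have s0 : 0 < s by rewrite divr_gt0// lt_min a0 b0.
have sa : s < a.
  by rewrite ltr_pdivrMr// (@le_lt_trans _ _ a)// ?ge_min ?lexx// ltr_pMr// ltr1n.
have sb : s < b.
  by rewrite ltr_pdivrMr// (@le_lt_trans _ _ b)// ?ge_min ?lexx ?orbT// ltr_pMr// ltr1n.
have sq x' y' : x <= x' <= x + s -> y <= y' <= y + s -> [/\ U (pt x' y'),
    `|pd i2 (pd i1 h) u - pd i2 (pd i1 h) (pt x' y')| < e / 2 &
    `|pd i1 (pd i2 h) u - pd i1 (pd i2 h) (pt x' y')| < e / 2].
  move=> hx hy; apply: (AB (x', y')); split => /=; [apply: aA|apply: bB].
    by rewrite /ball /= ltr_norml; lra.
  by rewrite /ball /= ltr_norml; lra.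
have [|[c1 c2] /= [c1x c2y E12]] := @second_difference (fun x y => h (pt x y))
  (fun x y => pd i1 h (pt x y)) (fun x y => pd i2 (pd i1 h) (pt x y)) x y s s0.
  move=> x' y' hx hy; have [Ux _ _] := sq _ _ hx hy.
  by split; [apply/is_pd_pt1|apply/is_pd_pt2];
    apply: smooth_is_pd Ux => //; exact: smooth_pd.
have [|[d1 d2] /= [d1y d2x E21]] := @second_difference (fun y x => h (pt x y))
  (fun y x => pd i2 h (pt x y)) (fun y x => pd i1 (pd i2 h) (pt x y)) y x s s0.
  move=> y' x' hy hx; have [Ux _ _] := sq _ _ hx hy.
  by split; [apply/is_pd_pt2|apply/is_pd_pt1];
    apply: smooth_is_pd Ux => //; exact: smooth_pd.
have E : pd i2 (pd i1 h) (pt c1 c2) = pd i1 (pd i2 h) (pt d2 d1).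
  have sn0 : s != 0 by rewrite gt_eqF.
  move: E12 E21; move: (pd i2 _ _) (pd i1 _ _) => p q E12 E21.
  by apply/(mulIf sn0)/(mulIf sn0); rewrite -E12 -E21; ring.
have wk z c : z < c < z + s -> z <= c <= z + s by move=> /andP[? ?]; rewrite !ltW.
have [_ near12 _] := sq _ _ (wk _ _ c1x) (wk _ _ c2y).
have [_ _ near21] := sq _ _ (wk _ _ d2x) (wk _ _ d1y).
exact: close_eq E near12 near21.
Qed.

Lemma pd_commC (U : set 'rV[R]_2) h : open U -> smooth_on U h ->
  forall i j u, U u -> pd i (pd j h) u = pd j (pd i h) u.
Proof.
move=> Uo hs i j u Uu.
by case: (I2_case i) => ->; case: (I2_case j) => ->;
  [reflexivity|exact: pd_comm Uu|exact/esym/(pd_comm Uo hs Uu)|reflexivity].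
Qed.

End SecondDifference.

(** * Antiderivatives on an open interval *)

Section Antiderivative.
Context {R : realType}.
Notation mu := (@lebesgue_measure R).

(** The fundamental theorem of calculus differentiates the integral from a only
    to the right of a, whereas G must be differentiable on both sides of x0.
    So G x is the integral from x0 to x computed through a starting point to
    the left of both; by Chasles' relation its choice is immaterial, hence it
    may be kept fixed near a given x. *)
Lemma antiderivative (I : set R) (f : R -> R) (x0 : R) :
  open I -> is_interval I -> (forall x, I x -> {for x, continuous f}) -> I x0 ->
  exists G, G x0 = 0 /\ forall x, I x -> is_derive x 1 G (f x).
Proof.
move=> Io Iitv fc Ix0.
have itg a c : I a -> I c -> mu.-integrable `[a, c] (EFin \o f).
  move=> Ia Ic; apply: continuous_compact_integrable; first exact: segment_compact.
  apply: continuous_in_subspaceT => z; rewrite inE /= in_itv /= => zac.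
  by apply: fc; exact: Iitv zac.
pose S a x := (\int[mu]_(t in `[a, x]) f t)%R.
have Chasles a a' x : I a -> I x -> a <= a' <= x -> S a x = S a a' + S a' x.
  move=> Ia Ix /andP[aa' a'x]; have Ia' : I a' by apply: (Iitv a x) => //; apply/andP.
  have /= := @Rintegral_itvB _ f (BLeft a) (BRight x) a' (itg _ _ Ia Ix).
  rewrite !bnd_simp => /(_ aa' a'x) /eqP; rewrite subr_eq => /eqP E.
  rewrite /S E addrC Rintegral_itv_obnd_cbnd//.
  apply: integrableS (itg _ _ Ia' Ix) => //.
  by move=> z /=; rewrite !in_itv /= => /andP[/ltW -> ->].
(* The integral is differentiable at x only below an upper bound c. *)
have rg x : I x -> exists2 c, I c & x < c.
  move=> Ix; have /nbhs_ballP[e /= e0 eI] := open_nbhs_nbhs (conj Io Ix).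
  exists (x + e / 2); last by rewrite ltrDl divr_gt0.
  by apply: eI; rewrite /ball /= ltr_norml; lra.
have lf x : exists a, I x -> [/\ I a, a < x & a < x0].
  have [Ix|nIx] := pselect (I x); last by exists 0 => /nIx.
  have Im : I (Num.min x x0) by rewrite minEle; case: ifP.
  have /nbhs_ballP[e /= e0 eI] := open_nbhs_nbhs (conj Io Im).
  have ltm : Num.min x x0 - e / 2 < Num.min x x0.
    by rewrite ltrBlDr ltrDl divr_gt0.
  exists (Num.min x x0 - e / 2) => _; split.
  - by apply: eI; rewrite /ball /= ltr_norml; lra.
  - by apply: lt_le_trans ltm _; rewrite ge_min lexx.
  - by apply: lt_le_trans ltm _; rewrite ge_min lexx orbT.
have [a aP] := choice lf.
have indep c d x : I c -> I d -> I x -> c < x -> c < x0 -> d < x -> d < x0 ->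
    S c x - S c x0 = S d x - S d x0.
  move=> Ic Id Ix cx cx0 dx dx0; wlog cd : c d Ic Id cx cx0 dx dx0 / c <= d.
    by move=> H; have [cd|/ltW dc] := leP c d; [exact: H|symmetry; exact: H].
  rewrite (Chasles c d x) ?(Chasles c d x0) ?cd ?ltW//.
  by rewrite opprD addrACA subrr add0r.
exists (fun x => S (a x) x - S (a x) x0); split; first by rewrite subrr.
move=> x Ix; have [Ia ax ax0] := aP x Ix; have [c Ic xc] := rg x Ix.
have [dS S'] := continuous_FTC1_closed xc (itg _ _ Ia Ic) ax (fc _ Ix).
rewrite -/(S (a x)) in dS S'.
have dd : is_derive x 1 (fun y => S (a x) y - S (a x) x0) (f x).
  apply: (@is_derive_eq _ _ _ _ _ _ _ (f x - 0)); last by rewrite subr0.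
  apply: is_deriveB; apply: DeriveDef => //.
  by rewrite -derive1E.
apply: near_eq_is_derive dd.
have nI : \forall y \near x, I y by apply: open_nbhs_nbhs.
have na : \forall y \near x, a x < y by exact: lt_nbhsr.
near=> y; have Iy : I y by near: y.
have [Iay ayy ayx0] := aP y Iy.
by apply: indep => //; near: y.
Unshelve. all: by end_near. Qed.

End Antiderivative.

(** * Potentials of closed forms on a box *)

Section Poincare.
Context {R : realType}.
Implicit Types (x y s t e c : R) (u : 'rV[R]_2).

(** Form of the mean value theorem that does not depend on the order of a and
    b, for use with increments of either sign. *)
Lemma mvt_itv (J : set R) (f df : R -> R) a b : is_interval J ->
  (forall x, J x -> is_derive x 1 f (df x)) -> J a -> J b ->
  exists2 c, J c & f b - f a = df c * (b - a).
Proof.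
move=> Jitv fd; wlog ab : a b / a <= b.
  move=> H Ja Jb; have [ab|/ltW ba] := leP a b; first exact: H.
  have [c Jc E] := H b a ba Jb Ja.
  by exists c => //; rewrite -opprB E -mulrN opprB.
move=> Ja Jb; move: ab; rewrite le_eqVlt => /predU1P[<-|ab].
  by exists a => //; rewrite !subrr mulr0.
have Jab x : a <= x <= b -> J x by exact: Jitv.
have [|c /andP[ac cb] E] := @mvt _ f df a b ab; first by move=> x /Jab /fd.
by exists c => //; apply: Jab; rewrite !ltW.
Qed.

Lemma is_derive_small_o (f : R -> R) y d :
  (forall e, 0 < e ->
     \forall k \near 0, `|f (y + k) - f y - k * d| <= e * `|k|) ->
  is_derive y 1 f d.
Proof.
move=> fd; suff H : (fun h => h^-1 *: ((f \o shift y) (h *: 1) - f y)) @ 0^' --> d.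
  by apply: DeriveDef; [apply/cvg_ex; exists d|exact: cvg_lim H].
apply/cvgrPdist_le => e e0; have fde := fd _ e0.
have nz : \forall k \near 0^', k != 0 :> R by exact: nbhs_dnbhs_neq.
have {}fde : \forall k \near 0^', `|f (y + k) - f y - k * d| <= e * `|k|.
  exact: cvg_within fde.
near=> k; have k0 : k != 0 by near: k.
have : `|f (y + k) - f y - k * d| <= e * `|k| by near: k.
rewrite -ler_pdivrMr ?normr_gt0// -normfV -normrM => le.
apply: le_trans le; rewrite distrC /= /GRing.scale /= mulr1 (addrC k y).
by rewrite le_eqVlt; apply/orP; left; apply/eqP; congr `|_|; field.
Unshelve. all: by end_near. Qed.

(** Differentiation under the integral sign. If g(s,t) is the integral of P(.,t)
    from x0 to s and P2 = dP/dt = dQ/ds, then the increment of g(x,.) from y to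
    y + k, minus k (Q(x,y) - Q(x0,y)), is the increment between x0 and x of a
    function of s with derivative P(s,y+k) - P(s,y) - k P2(s,y). Two
    applications of the mean value theorem turn it into
    k (P2(c,t) - P2(c,y)) (x - x0), and uniform continuity of P2 along the
    compact segment makes this o(k). *)
Lemma derive_antiderivative (K : set R) (J : set R) (y x0 x : R)
    (g P Q : R -> R -> R) (P2 : R -> R -> R) :
  compact K -> is_interval K -> open J -> J y ->
  K x0 -> K x ->
  (forall s t, K s -> J t -> is_derive s 1 (g^~ t) (P s t)) ->
  (forall t, J t -> g x0 t = 0) ->
  (forall s t, K s -> J t -> is_derive t 1 (P s) (P2 s t)) ->
  (forall s, K s -> is_derive s 1 (Q^~ y) (P2 s y)) ->
  (forall s e, K s -> 0 < e ->
     \forall s' \near s & t \near y, `|P2 s y - P2 s' t| < e) ->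
  is_derive y 1 (g x) (Q x y - Q x0 y).
Proof.
move=> cK iK Jo Jy Kx0 Kx g1 g0 PP2 QP2 cP2.
apply: is_derive_small_o => e e0.
(* The 1 only keeps the denominator positive when x = x0. *)
pose e' := e / (`|x - x0| + 1).
have x1 : 0 < `|x - x0| + 1 by rewrite ltr_wpDl.
have e'0 : 0 < e' by rewrite divr_gt0.
(* A positive radius in k that serves for every s in K at once. *)
have unif : \forall k \near (0 : R), K `<=` (fun s => `|P2 s y - P2 s (y + k)| < e').
  apply: (proj1 (compact_near_coveringP K) cK R (nbhs (0 : R))
    (fun k s => `|P2 s y - P2 s (y + k)| < e') _) => s Ks.
  have e'20 : 0 < e' / 2 by rewrite divr_gt0.
  have [[A B] /= [As By] AB] := cP2 _ _ Ks e'20.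
  have nB : \forall k \near (0 : R), B (y + k).
    have : (fun k : R => y + k) @ 0 --> y + 0.
      by apply: cvgD; [exact: cvg_cst|exact: cvg_id].
    by rewrite addr0; apply.
  exists (A, [set k | B (y + k)]) => // -[s' k] /= [As' Bk].
  have H1 := AB (s', y) (conj As' (nbhs_singleton By)).
  have H2 := AB (s', y + k) (conj As' Bk).
  rewrite (splitr e'); apply: le_lt_trans (ler_distD (P2 s y) _ _) _.
  by apply: ltrD => //; rewrite distrC.
have nJ : \forall k \near (0 : R), J (y + k).
  have : (fun k : R => y + k) @ 0 --> y + 0.
    by apply: cvgD; [exact: cvg_cst|exact: cvg_id].
  by rewrite addr0; apply; exact: open_nbhs_nbhs.
have /nbhs_ballP[d /= d0 dUJ] : \forall k \near (0 : R),
    J (y + k) /\ (K `<=` (fun s => `|P2 s y - P2 s (y + k)| < e')).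
  by apply: filterS2 nJ unif.
apply/nbhs_ballP; exists d => //= k; rewrite /ball /= sub0r normrN => kd.
pose L := [set t : R | `|t - y| <= `|k|].
have iL : is_interval L.
  move=> a b; rewrite /L /= !ler_norml => /andP[Ha _] /andP[_ Hb] z /andP[az zb].
  by rewrite ler_norml; apply/andP; split; lra.
have LJ t : L t -> J t /\ forall s, K s -> `|P2 s y - P2 s t| < e'.
  rewrite /L /= => Lt; rewrite -(subrKC y t).
  apply: (dUJ (t - y)); rewrite /ball /= sub0r normrN; exact: le_lt_trans Lt kd.
have Ly : L y by rewrite /L /= subrr normr0.
have Lk : L (y + k) by rewrite /L /= addrC addKr.
have [Jk _] := LJ _ Lk.
have [c Kc E] := @mvt_itv K (fun s => g s (y + k) - g s y - k * Q s y)
  (fun s => P s (y + k) - P s y - k * P2 s y) x0 x iK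
  (fun s Ks => is_deriveB (is_deriveB (g1 _ _ Ks Jk) (g1 _ _ Ks Jy))
                 (is_deriveZ k (QP2 _ Ks))) Kx0 Kx.
have [t Lt E'] := @mvt_itv L (P c) (P2 c) y (y + k) iL
  (fun t Lt => PP2 _ _ Kc (LJ _ Lt).1) Ly Lk.
have [_ /(_ _ Kc) cl] := LJ _ Lt.
have -> : g x (y + k) - g x y - k * (Q x y - Q x0 y) =
    (P2 c t - P2 c y) * k * (x - x0).
  transitivity ((P c (y + k) - P c y - k * P2 c y) * (x - x0)).
    by rewrite -E (g0 _ Jk) (g0 _ Jy); ring.
  by rewrite E'; ring.
rewrite !normrM mulrAC ler_wpM2r// distrC.
have -> : e = e' * (`|x - x0| + 1) by rewrite /e' divfK// gt_eqF.
by rewrite ler_pM// ?ltW// ltrDl.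
Qed.

End Poincare.

Section Potential.
Context {R : realType}.
Implicit Types (x y s t e c : R) (u v : 'rV[R]_2).

(** Partial derivatives that are continuous at u are bounded near u, so F is
    Lipschitz near u by the mean value theorem along each axis. *)
Lemma continuous_of_pd (U : set 'rV[R]_2) (F P Q : 'rV[R]_2 -> R) : open U ->
  (forall u, U u -> is_pd i1 F u (P u)) ->
  (forall u, U u -> is_pd i2 F u (Q u)) ->
  forall u, U u -> {for u, continuous P} -> {for u, continuous Q} ->
  {for u, continuous F}.
Proof.
move=> Uo FP FQ u Uu cP cQ; pose M := `|P u| + `|Q u| + 1.
have M0 : 0 < M by rewrite ltr_wpDl// addr_ge0.
have nP : \forall v \near u, `|P v| <= M.
  have : \forall v \near u, `|P u - P v| < 1 by move/cvgrPdist_lt : cP; apply.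
  apply: filterS => v; rewrite distrC => lt1.
  rewrite -(subrK (P u) (P v)); apply: le_trans (ler_normD _ _) _.
  by rewrite /M; have := normr_ge0 (Q u); lra.
have nQ : \forall v \near u, `|Q v| <= M.
  have : \forall v \near u, `|Q u - Q v| < 1 by move/cvgrPdist_lt : cQ; apply.
  apply: filterS => v; rewrite distrC => lt1.
  rewrite -(subrK (Q u) (Q v)); apply: le_trans (ler_normD _ _) _.
  by rewrite /M; have := normr_ge0 (P u); lra.
have nU : \forall v \near u, U v by exact: (open_near Uo _ Uu).
have {nP nQ nU} : \forall v \near u, [/\ U v, `|P v| <= M & `|Q v| <= M].
  by apply: filterS3 nU nP nQ => v; split.
rewrite -{1}(pt_eta u) => /near_pt.
move: (u 0 i1) (u 0 i2) (pt_eta u) => x y uE.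
move=> [[A B] /= [/nbhs_ballP[a /= a0 aA] /nbhs_ballP[b /= b0 bB]] AB].
have ballI (z r : R) : is_interval (ball z r : set R).
  move=> p q; rewrite /ball /= !ltr_norml => /andP[p1 p2] /andP[q1 q2] t /andP[pt tq].
  by rewrite ltr_norml; apply/andP; split; lra.
have bnd s t : ball x a s -> ball y b t ->
    `|F (pt s t) - F u| <= M * (`|s - x| + `|t - y|).
  move=> xs yt; have ax : ball x a x by exact: ballxx.
  have by_ : ball y b y by exact: ballxx.
  have sq s' t' : ball x a s' -> ball y b t' ->
      [/\ U (pt s' t'), `|P (pt s' t')| <= M & `|Q (pt s' t')| <= M].
    by move=> /aA ? /bB ?; exact: (AB (s', t')).
  have [c xc Ec] := @mvt_itv _ _ (fun z => F (pt z t)) (fun z => P (pt z t)) x s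
     (ballI x a)
     (fun z xz => (is_pd_pt1 _ _ _ _).1
       (FP _ (let: And3 h _ _ := sq z t xz yt in h))) ax xs.
  have [d yd Ed] := @mvt_itv _ _ (fun z => F (pt x z)) (fun z => Q (pt x z)) y t
     (ballI y b)
     (fun z yz => (is_pd_pt2 _ _ _ _).1
       (FQ _ (let: And3 h _ _ := sq x z ax yz in h))) by_ yt.
  have [_ Pc _] := sq _ _ xc yt; have [_ _ Qd] := sq _ _ ax yd.
  rewrite -uE -(subrKA (F (pt x t))); apply: le_trans (ler_normD _ _) _.
  by rewrite Ec Ed !normrM mulrDr lerD// ler_wpM2r.
rewrite /prop_for /continuous_at; apply/(@cvgrPdist_le _ _ _ (nbhs u)) => e e0.
pose r := Num.min (Num.min a b) (e / (M * 2)).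
have r0 : 0 < r by rewrite !lt_min a0 b0 /= divr_gt0// mulr_gt0.
have : \forall s \near x & t \near y, `|F u - F (pt s t)| <= e.
  exists (ball x r, ball y r); first by split=> /=; exact: nbhsx_ballx.
  move=> [s t] [/= xs yt]; rewrite distrC.
  have sa : ball x a s by apply: le_ball xs; rewrite !ge_min lexx.
  have tb : ball y b t by apply: le_ball yt; rewrite !ge_min lexx orbT.
  apply: le_trans (bnd _ _ sa tb) _.
  have small (z w : R) : ball z r w -> `|w - z| <= e / (M * 2).
    rewrite /ball /= => zw; rewrite distrC; apply: le_trans (ltW zw) _.
    by rewrite !ge_min lexx orbT.
  apply: le_trans (ler_wpM2l (ltW M0) (lerD (small _ _ xs) (small _ _ yt))) _.
  by rewrite le_eqVlt; apply/orP; left; apply/eqP; field; rewrite gt_eqF.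
move=> near_xy.
have : \forall v \near u,
    `|F u - F (pt ((v : 'rV[R]_2) 0 i1) ((v : 'rV[R]_2) 0 i2))| <= e.
  apply: (@near_unpt _ u (fun s t => `|F u - F (pt s t)| <= e)).
  have -> : u 0 i1 = x by rewrite -uE pt1.
  by have -> : u 0 i2 = y by rewrite -uE pt2.
by apply: filterS => v; rewrite pt_eta.
Qed.

Lemma smooth_of_pd (U : set 'rV[R]_2) (F P Q : 'rV[R]_2 -> R) : open U ->
  (forall u, U u -> is_pd i1 F u (P u)) ->
  (forall u, U u -> is_pd i2 F u (Q u)) ->
  smooth_on U P -> smooth_on U Q -> smooth_on U F.
Proof.
move=> Uo FP FQ Ps Qs.
have cF u : U u -> {for u, continuous F}.
  move=> Uu; apply: (continuous_of_pd Uo FP FQ Uu).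
    exact: (smooth_cont Ps Uu).
  exact: (smooth_cont Qs Uu).
case=> [|k]; split => // i; case: (I2_case i) => ->; split.
- by move=> u /FP /is_pd_derivable.
- by apply: Ck_eq (Ps k) => // u /FP /is_pd_val.
- by move=> u /FQ /is_pd_derivable.
- by apply: Ck_eq (Qs k) => // u /FQ /is_pd_val.
Qed.

(** The potential is F(x,y) = int_{x0}^x P(s,y) ds + int_{y0}^y Q(x0,t) dt. Its
    derivative in y is (Q(x,y) - Q(x0,y)) + Q(x0,y) by
    [derive_antiderivative]. *)
Lemma poincare (I : 'I_2 -> set R) (P Q : 'rV[R]_2 -> R) :
  (forall i, open (I i)) -> (forall i, is_interval (I i)) ->
  smooth_on (box I) P -> smooth_on (box I) Q ->
  (forall u, box I u -> pd i2 P u = pd i1 Q u) ->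
  exists F, [/\ smooth_on (box I) F,
    forall u, box I u -> pd i1 F u = P u &
    forall u, box I u -> pd i2 F u = Q u].
Proof.
move=> Io Ii Ps Qs PQ; have Uo := open_box Io.
suff [F [FP FQ]] : exists F, (forall u, box I u -> is_pd i1 F u (P u)) /\
                        (forall u, box I u -> is_pd i2 F u (Q u)).
  exists F; split; first exact: smooth_of_pd FP FQ Ps Qs.
    by move=> u /FP /is_pd_val.
  by move=> u /FQ /is_pd_val.
have [[u0 Uu0]|noU] := pselect (exists u, box I u); last first.
  by exists (fun=> 0); split=> u Uu; case: noU; exists u.
pose x0 := u0 0 i1; pose y0 := u0 0 i2.
have Ix0 : I i1 x0 by exact: Uu0.
have Iy0 : I i2 y0 by exact: Uu0.
have bI s t : I i1 s -> I i2 t -> box I (pt s t) by move=> ? ?; apply/box_pt.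
have cs h s t : smooth_on (box I) h -> I i1 s -> I i2 t ->
    forall e, 0 < e -> \forall s' \near s & t' \near t, `|h (pt s t) - h (pt s' t')| < e.
  move=> hs Is It e e0; apply: (@near_pt _ s t (fun v => `|h (pt s t) - h v| < e)).
  by move/cvgrPdist_lt : (smooth_cont hs (bI _ _ Is It)); apply.
have /choice[g gP] : forall t, exists gt : R -> R, I i2 t -> gt x0 = 0 /\
    forall s, I i1 s -> is_derive s 1 gt (P (pt s t)).
  move=> t.
  have [It|nIt] := pselect (I i2 t); last by exists (fun=> 0) => /nIt.
  have [|gt [gt0 gtP]] := @antiderivative _ _ (fun s => P (pt s t)) _
    (Io i1) (Ii i1) _ Ix0.
    move=> s Is; apply/differentiable_continuous/derivable1_diffP.
    have [] // := (is_pd_pt1 _ _ _ _).1 (smooth_is_pd i1 Ps (bI _ _ Is It)).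
  by exists gt.
have [|B [_ BP]] := @antiderivative _ _ (fun t => Q (pt x0 t)) _
  (Io i2) (Ii i2) _ Iy0.
  move=> t It; apply/differentiable_continuous/derivable1_diffP.
  have [] // := (is_pd_pt2 _ _ _ _).1 (smooth_is_pd i2 Qs (bI _ _ Ix0 It)).
exists (fun u => g (u 0 i2) (u 0 i1) + B (u 0 i2)); split=> u Uu.
- rewrite -(pt_eta u); move: (Uu i1) (Uu i2); move: (u 0 i1) (u 0 i2) => x y Ix Iy.
  apply/is_pd_pt1.
  rewrite (_ : (fun _ => _) = (fun s => g y s + B y)); last first.
    by apply/funext => s; rewrite !pt1 !pt2.
  exact: is_derive_eq (is_deriveD ((gP _ Iy).2 _ Ix) (is_derive_cst _ _ _)) (addr0 _).
- rewrite -(pt_eta u); move: (Uu i1) (Uu i2); move: (u 0 i1) (u 0 i2) => x y Ix Iy.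
  apply/is_pd_pt2.
  rewrite (_ : (fun _ => _) = (fun t => g t x + B t)); last first.
    by apply/funext => s; rewrite !pt1 !pt2.
  apply: is_derive_eq (is_deriveD _ (BP _ Iy)) (subrK _ (Q (pt x y))).
  pose K := `[Num.min x0 x, Num.max x0 x]%classic.
  have KI : K `<=` I i1.
    move=> s; rewrite /K /= in_itv /= => sK; apply: (Ii i1 (Num.min x0 x) (Num.max x0 x)) sK.
      by rewrite minEle; case: ifP.
    by rewrite maxEle; case: ifP.
  apply: (@derive_antiderivative R K (I i2) y x0 x (fun s t => g t s)
    (fun s t => P (pt s t)) (fun s t => Q (pt s t)) (fun s t => pd i2 P (pt s t))) => //.
  + exact: segment_compact.
  + exact: interval_is_interval.
  + by rewrite /K /= in_itv /= ge_min le_max lexx.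
  + by rewrite /K /= in_itv /= ge_min le_max lexx !orbT.
  + by move=> s t /KI Is It; exact: (gP _ It).2.
  + by move=> t It; exact: (gP _ It).1.
  + move=> s t /KI Is It; apply/is_pd_pt2; exact: smooth_is_pd (bI _ _ Is It).
  + move=> s /KI Is; apply/is_pd_pt1; rewrite (PQ _ (bI _ _ Is Iy)).
    exact: smooth_is_pd (bI _ _ Is Iy).
  + by move=> s e /KI Is; apply: cs => //; exact: smooth_pd.
Qed.

End Potential.

(** * Curvature of diagonal metrics of the plane *)

Section DiagonalMetric.
Context {R : realType}.
Variables (eps : 'I_2 -> R) (b : 'I_2 -> 'rV[R]_2 -> R).
Implicit Types (i j k l : 'I_2) (u : 'rV[R]_2).

Definition diag_metric (phi : 'I_2 -> R -> R) : 'rV[R]_2 -> 'M[R]_2 :=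
  fun u => diag_mx (\row_i (eps i * phi i (u 0 i) / b i u ^+ 2)).

(** Rotation coefficients (in the sense of Darboux) of the diagonal metric with
    Lame coefficients b^i. *)
Definition rotation i j : 'rV[R]_2 -> R := fun u => pd i (b j) u / b i u.

(** The left-hand side of the flatness condition of [diag_metric phi], cleared
    of denominators. In terms of the Lame coefficients b^i / sqrt(phi_i) of that
    metric, and of their rotation coefficients beta, it is the classical
    equation eps_i d_i beta_ij + eps_j d_j beta_ji = 0; expanding the square
    roots makes it linear in phi and free of sign conditions on phi. *)
Definition flatness (phi : 'I_2 -> R -> R) i j u : R :=
  eps i * (phi i (u 0 i) * pd i (rotation i j) u
           + derive1 (phi i) (u 0 i) / 2 * rotation i j u)
  + eps j * (phi j (u 0 j) * pd j (rotation j i) u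
             + derive1 (phi j) (u 0 j) / 2 * rotation j i u).

(** Indices i and j != i exhaust the two values: this lets the computations below
    be done once for an arbitrary i and its companion j. *)
Lemma I2_other i j k : i != j -> k = i \/ k = j.
Proof.
by case: (I2_case i) => ->; case: (I2_case j) => -> //;
  case: (I2_case k) => ->; auto.
Qed.

Lemma sum_I2 (i j : 'I_2) (F : 'I_2 -> R) : i != j -> \sum_s F s = F i + F j.
Proof.
move=> ij; rewrite (bigD1 i) //= (bigD1 j) 1?eq_sym //= big1 ?addr0 // => s.
by case: (I2_other s ij) => ->; rewrite eqxx ?andbF.
Qed.

Section Fixed.
Variables (J : 'I_2 -> set R) (phi : 'I_2 -> R -> R).
(* J is a separate parameter because the members of a pencil are metrics only
   on a smaller box than the one on which b is given. *)
Hypothesis Jo : forall i, open (J i).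
Hypothesis eps1 : forall i, eps i * eps i = 1.
Hypothesis bs : forall i, smooth_on (box J) (b i).
Hypothesis b0 : forall i u, box J u -> b i u != 0.
Hypothesis phis : forall i, smooth_on (box J) (fun u => phi i (u 0 i)).
Hypothesis phid : forall i x, J i x -> derivable (phi i) x 1.
Hypothesis phi0 : forall i x, J i x -> phi i x != 0.

Let g := diag_metric phi.
Let Uo : open (box J) := open_box Jo.

Let p0 i u : box J u -> phi i (u 0 i) != 0.
Proof. by move=> Uu; apply: phi0; exact: Uu. Qed.

Let e0 i : eps i != 0.
Proof. by apply/eqP => e; have := eps1 i; rewrite e mul0r => /eqP; rewrite eq_sym oner_eq0. Qed.

Definition lower i u : R := eps i * b i u ^+ 2 / phi i (u 0 i).

Lemma metricE i j u :
  g u i j = (i == j)%:R * (eps i * phi i (u 0 i) / b i u ^+ 2).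
Proof. by rewrite /g /diag_metric mxE mxE mulr_natl. Qed.

(** The entry of the covariant metric is [lower i] because 1 / eps_i = eps_i. *)
Lemma covE i j u : box J u -> cov g i j u = (i == j)%:R * lower i u.
Proof.
move=> Uu; pose B : 'M[R]_2 := diag_mx (\row_i lower i u).
have gB : g u *m B = 1%:M.
  rewrite /g /diag_metric mulmx_diag -diag_const_mx; congr diag_mx.
  apply/rowP => s; rewrite !mxE /lower.
  transitivity (eps s * eps s); last exact: eps1.
  by have := p0 s Uu; have := b0 s Uu => ? ?; field; apply/andP.
have [gU _] := mulmx1_unit gB.
have -> : cov g i j u = B i j by rewrite /cov -[B](mulKmx gU) gB mulmx1.
by rewrite mxE mxE mulr_natl.
Qed.

Lemma is_pd_phi i k u : box J u ->
  is_pd k (fun v => phi i (v 0 i)) u ((k == i)%:R * derive1 (phi i) (u 0 i)).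
Proof.
move=> Uu; have [->|ki] := eqVneq k i; last first.
  by rewrite mul0r; exact: is_pd_coord_neq.
by rewrite mul1r; apply: is_pd_coord; apply: phid; exact: Uu.
Qed.

Lemma is_pd_b i k u : box J u -> is_pd k (b i) u (pd k (b i) u).
Proof. exact: smooth_is_pd. Qed.

Lemma pd_lower i k u : box J u -> pd k (lower i) u =
  eps i * (2 * b i u * pd k (b i) u / phi i (u 0 i)
    - (k == i)%:R * b i u ^+ 2 * derive1 (phi i) (u 0 i) / phi i (u 0 i) ^+ 2).
Proof.
move=> Uu; apply: is_pd_val; apply: is_pd_eq.
  apply: is_pd_div (p0 i Uu) (is_pdM (is_pd_cst k (eps i) u)
    (is_pdM (is_pd_b i k Uu) (is_pd_b i k Uu))) (is_pd_phi i k Uu).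
have := p0 i Uu; generalize (phi i (u 0 i)) (b i u) (pd k (b i) u) (derive1 (phi i) (u 0 i)).
by move=> p c dc dp ph; field.
Qed.

(** Logarithmic derivative of phi_i, at the i-th coordinate of u. *)
Definition dlog i u : R := derive1 (phi i) (u 0 i) / phi i (u 0 i).

Lemma christoffelE i j k u : box J u -> christoffel g i j k u =
  2^-1 * (eps i * phi i (u 0 i) / b i u ^+ 2) *
  ((i == k)%:R * pd j (lower i) u + (i == j)%:R * pd k (lower i) u
   - (j == k)%:R * pd i (lower j) u).
Proof.
have pd_cov m s t v : box J v -> pd m (cov g s t) v = (s == t)%:R * pd m (lower s) v.
  move=> Uv; rewrite (pd_open m Uo (fun w => @covE s t w) Uv); apply: is_pd_val.
  have : is_pd m (lower s) v (pd m (lower s) v).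
    apply: is_pd_pd; apply: is_pd_derivable.
    apply: is_pd_div (p0 s Uv) (is_pdM (is_pd_cst m (eps s) v)
      (is_pdM (is_pd_b s m Uv) (is_pd_b s m Uv))) (is_pd_phi s m Uv).
  move=> /(is_pdM (is_pd_cst m (s == t)%:R v)) H; apply: is_pd_eq H _.
  by rewrite mul0r add0r.
move=> Uu; rewrite /christoffel (bigD1 i)//= big1 ?addr0; last first.
  by move=> s si; rewrite metricE eq_sym (negbTE si) mul0r mul0r.
by rewrite !pd_cov// metricE eqxx mul1r mulrA.
Qed.

Lemma christoffel_sym i j k u : box J u ->
  christoffel g i j k u = christoffel g i k j u.
Proof.
move=> Uu; rewrite !christoffelE// [k == j]eq_sym.
have -> : (j == k)%:R * pd i (lower k) u = (j == k)%:R * pd i (lower j) u.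
  by have [->|_] := eqVneq j k; [reflexivity|rewrite !mul0r].
generalize (pd j (lower i) u) (pd k (lower i) u) (pd i (lower j) u) => x y z.
by ring.
Qed.

Lemma christoffel_diag i u : box J u ->
  christoffel g i i i u = pd i (b i) u / b i u - 2^-1 * dlog i u.
Proof.
move=> Uu; rewrite christoffelE// pd_lower// !eqxx /dlog /=.
have := p0 i Uu; have := b0 i Uu; have := eps1 i; generalize (eps i).
generalize (phi i (u 0 i)) (b i u) (pd i (b i) u) (derive1 (phi i) (u 0 i)).
move=> p c dc dp e ee c0 pp; transitivity ((e * e) * (dc / c - 2^-1 * (dp / p))).
  by field; apply/andP.
by rewrite ee mul1r.
Qed.

Lemma christoffel_mixed i j u : i != j -> box J u ->
  christoffel g i i j u = pd j (b i) u / b i u.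
Proof.
move=> ij Uu; rewrite christoffelE// (pd_lower i j Uu) eqxx [j == i]eq_sym (negbTE ij) /=.
have := p0 i Uu; have := b0 i Uu; have := eps1 i; generalize (eps i).
generalize (phi i (u 0 i)) (b i u) (pd i (b i) u) (pd j (b i) u) (derive1 (phi i) (u 0 i))
  (pd i (lower i) u).
move=> p c dc dc' dp x e ee c0 pp.
transitivity ((e * e) * (dc' / c)); last by rewrite ee mul1r.
by field; apply/andP.
Qed.

Lemma christoffel_off i j u : i != j -> box J u ->
  christoffel g i j j u = - (eps i * eps j) *
    ((phi i (u 0 i) * (b j u * rotation i j u)) / (phi j (u 0 j) * b i u)).
Proof.
move=> ij Uu; rewrite christoffelE// (pd_lower j i Uu) eqxx (negbTE ij) /rotation /=.
have := p0 i Uu; have := p0 j Uu; have := b0 i Uu; have := b0 j Uu.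
generalize (phi i (u 0 i)) (phi j (u 0 j)) (b i u) (b j u) (pd i (b j) u) (pd j (lower i) u)
 (derive1 (phi j) (u 0 j)).
move=> p p' c c' dc x dp c'0 c0 pp' pp; field.
by apply/andP.
Qed.

Lemma is_pd_rotation i j k u : box J u -> is_pd k (rotation i j) u (pd k (rotation i j) u).
Proof.
move=> Uu; apply: is_pd_pd; apply: is_pd_derivable.
by apply: is_pd_div (b0 i Uu) (smooth_is_pd k (smooth_pd i (@bs j)) Uu) (is_pd_b i k Uu).
Qed.

Lemma pd_rotation i j u : box J u -> pd i (b j) u = rotation i j u * b i u.
Proof. by move=> Uu; rewrite /rotation divfK// b0. Qed.

Lemma christoffel_mixed_rotation i j u : i != j -> box J u ->
  christoffel g i i j u = rotation j i u * b j u / b i u.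
Proof. by move=> ij Uu; rewrite christoffel_mixed// pd_rotation. Qed.

Lemma riemann_anti i j k l u : riemann g i j k l u = - riemann g i j l k u.
Proof.
have opp (a c d e : R) : d = - e -> a - c + d = - (c - a + e).
  by move=> ->; ring.
by apply: opp; rewrite -sumrN; apply: eq_bigr => p _; rewrite opprB.
Qed.

(** The component that carries the whole curvature in dimension two. The
    terms in d_i b^i and d_j b^j cancel, leaving [flatness] times a nowhere
    vanishing factor. *)
Lemma riemann_off i j u : i != j -> box J u ->
  riemann g i j i j u = - (eps j * b j u / (b i u * phi j (u 0 j))) * flatness phi i j u.
Proof.
move=> ij Uu; have ji : j != i by rewrite eq_sym.
rewrite /riemann (sum_I2 _ ij).
rewrite (pd_open i Uo (fun v => christoffel_off ij) Uu).
rewrite (pd_open j Uo (fun v => christoffel_mixed_rotation ij) Uu).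
rewrite (christoffel_sym i j i Uu) (christoffel_sym j i j Uu).
rewrite !christoffel_diag // !christoffel_off // !christoffel_mixed_rotation //.
have nz : phi j (u 0 j) * b i u != 0 by rewrite mulf_neq0 ?p0 ?b0.
rewrite (is_pd_val (is_pdM (is_pd_cst i (- (eps i * eps j)) u)
  (is_pd_div nz
     (is_pdM (is_pd_phi i i Uu) (is_pdM (is_pd_b j i Uu) (is_pd_rotation i j i Uu)))
     (is_pdM (is_pd_phi j i Uu) (is_pd_b i i Uu))))).
rewrite (is_pd_val (is_pd_div (b0 i Uu)
  (is_pdM (is_pd_rotation j i j Uu) (is_pd_b j j Uu)) (is_pd_b i j Uu))).
rewrite (pd_rotation i j Uu) (pd_rotation j i Uu) eqxx (negbTE ij) /= /dlog /flatness.
have := p0 i Uu; have := p0 j Uu; have := b0 i Uu; have := b0 j Uu.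
have := eps1 i; have := eps1 j; have := e0 i; have := e0 j.
generalize (eps i) (eps j) (pd i (rotation i j) u) (pd j (rotation j i) u).
generalize (rotation i j u) (rotation j i u) (pd i (b i) u) (pd j (b j) u).
generalize (derive1 (phi i) (u 0 i)) (derive1 (phi j) (u 0 j)).
generalize (phi i (u 0 i)) (phi j (u 0 j)) (b i u) (b j u).
move=> p p' c c' dp dp' r r' dc dc' e e' dr dr' e'0 e00 ee' ee c'0 c0 pp' pp.
(* Isolates the factor e'^2 = 1 that appears when [flatness] is multiplied
   by e'; what remains are identities of rational functions. *)
transitivity (- (e * e') * (p * (c' * dr) / (p' * c) + dp / 2 * c' * r / (p' * c))
  - c' / (c * p') * (p' * dr' + dp' / 2 * r') * (e' * e')).
  rewrite ee'.
  by field; do ?[apply/andP; split].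
by field; do ?[apply/andP; split].
Qed.

(** The derivative terms are the mixed derivatives of log b^i, which cancel by
    symmetry; the quadratic terms cancel because eps_i^2 = eps_j^2 = 1. *)
Lemma riemann_diag i j u : i != j -> box J u -> riemann g i i i j u = 0.
Proof.
move=> ij Uu; have ji : j != i by rewrite eq_sym.
rewrite /riemann (sum_I2 _ ij).
rewrite (pd_open i Uo (fun v Uv => etrans (christoffel_sym i j i Uv)
   (christoffel_mixed ij Uv)) Uu).
rewrite (pd_open j Uo (@christoffel_diag i) Uu).
rewrite (christoffel_sym i j i Uu).
rewrite !christoffel_diag // !christoffel_off // !christoffel_mixed_rotation //.
have dlog0 : is_pd j (dlog i) u 0.
  exact: (is_pd_coord_neq (fun x => derive1 (phi i) x / phi i x) u ji).
have bi_smooth k : is_pd k (pd i (b i)) u (pd k (pd i (b i)) u) /\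
    is_pd k (pd j (b i)) u (pd k (pd j (b i)) u).
  by split; apply: smooth_is_pd Uu; exact: smooth_pd.
rewrite (is_pd_val (is_pd_div (b0 i Uu) (bi_smooth i).2 (is_pd_b i i Uu))).
rewrite (is_pd_val (is_pdD (is_pd_div (b0 i Uu) (bi_smooth j).1 (is_pd_b i j Uu))
  (is_pdN (is_pdM (is_pd_cst j 2^-1 u) dlog0)))).
rewrite (pd_commC Uo (bs i) i j Uu) /rotation.
have := p0 i Uu; have := p0 j Uu; have := b0 i Uu; have := b0 j Uu.
have := eps1 i; have := eps1 j.
generalize (eps i) (eps j) (dlog i u) (pd j (pd i (b i)) u).
generalize (pd i (b i) u) (pd j (b i) u) (pd i (b j) u).
generalize (phi i (u 0 i)) (phi j (u 0 j)) (b i u) (b j u).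
move=> p p' c c' di dj di' e e' dl dd ee' ee c'0 c0 pp' pp.
transitivity (dj / c * (di' / c') * (1 - (e * e) * (e' * e'))).
  by field; do ?[apply/andP; split].
by rewrite ee ee' mulr1 subrr mulr0.
Qed.

Lemma flatnessC i j u : flatness phi i j u = flatness phi j i u.
Proof. exact: addrC. Qed.

Lemma det_metric u : \det (g u) = \prod_i (eps i * phi i (u 0 i) / b i u ^+ 2).
Proof. by rewrite det_diag; apply: eq_bigr => i _; rewrite mxE. Qed.

Lemma is_metric_diag : is_metric_on (box J) g.
Proof.
split=> [i j k|u Uu]; last first.
  split; first exact: tr_diag_mx.
  rewrite det_metric prodf_seq_neq0; apply/allP => i _ /=.
  by rewrite !mulf_neq0 ?invr_eq0 ?expf_neq0 ?e0 ?p0 ?b0.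
have smooth_entry : Ck_on k (box J) (fun u => (i == j)%:R *
    (eps i * phi i (u 0 i) * (b i u * b i u)^-1)).
  have bk := bs i k.
  apply: CkM => //; first exact: Ck_cst.
  apply: CkM => //; first by apply: CkM => //; [exact: Ck_cst|exact: phis].
  by apply: CkV => //; [move=> u Uu; rewrite mulf_neq0 ?b0|apply: CkM].
by apply: Ck_eq smooth_entry => // u _; rewrite metricE.
Qed.

(** Antisymmetry in k and l reduces all components R^i_{jkl} to those of
    [riemann_off] and [riemann_diag]. *)
Lemma flat_metric_diag :
  flat_metric_on (box J) g <-> forall u, box J u -> flatness phi i1 i2 u = 0.
Proof.
split=> [[_ flat] u Uu|flat].
  have ij : i1 != i2 by [].
  have /eqP := flat i1 i2 i1 i2 u Uu; rewrite riemann_off// mulf_eq0 oppr_eq0.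
  rewrite !mulf_eq0 invr_eq0 mulf_eq0 (negbTE (e0 _)) (negbTE (b0 _ Uu)).
  by rewrite (negbTE (b0 _ Uu)) (negbTE (p0 _ Uu)) /= => /eqP.
split; first exact: is_metric_diag.
have {}flat i j u : i != j -> box J u -> flatness phi i j u = 0.
  move=> + /flat; case: (I2_case i) => ->; case: (I2_case j) => -> // _.
  by rewrite flatnessC.
have diag i j k u : box J u -> riemann g i j k k u = 0.
  move=> Uu; rewrite /riemann subrr add0r big1// => p _; exact: subrr.
have main i j l u : i != l -> box J u -> riemann g i j i l u = 0.
  move=> il Uu; case: (I2_other j il) => ->; first exact: riemann_diag.
  by rewrite riemann_off// flat// mulr0.
move=> i j k l u Uu; have [<-|kl] := eqVneq k l; first exact: diag.
case: (I2_other i kl) => ->; first exact: main.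
by rewrite riemann_anti main ?oppr0// eq_sym.
Qed.

Lemma contra_christoffelE i j k u : contra_christoffel g i j k u =
  eps i * phi i (u 0 i) / b i u ^+ 2 * christoffel g j i k u.
Proof.
rewrite /contra_christoffel (bigD1 i)//= big1 ?addr0.
  by rewrite metricE eqxx mul1r.
by move=> s si; rewrite metricE eq_sym (negbTE si) !mul0r.
Qed.

End Fixed.

(** The factors of phi_m and phi_m' in Gamma^{ij}_k, where m is
    [contra_index i j k]. They are read off from Gamma^{ij}_k = g^{ii}
    Gamma^j_{ik}, in which only one of phi_i and phi_j survives. *)
Definition contra_coef i j k u : R :=
  if i == j then
    if i == k then eps i * pd i (b i) u / b i u ^+ 3
    else eps i * pd k (b i) u / b i u ^+ 3
  else if i == k then - eps j * pd j (b i) u / (b i u * b j u ^+ 2)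
  else eps i * pd i (b j) u / (b j u * b i u ^+ 2).

Definition contra_dcoef i j k u : R :=
  if (i == j) && (i == k) then - eps i / (2 * b i u ^+ 2) else 0.

Definition contra_index i j k : 'I_2 := if i == k then j else i.

(** Linearity in phi is what makes the Levi-Civita connections of the pencil
    compatible, whatever the b^i are. *)
Lemma contra_christoffel_linear (J : 'I_2 -> set R) (phi : 'I_2 -> R -> R)
  (Jo : forall i, open (J i))
  (eps1 : forall i, eps i * eps i = 1)
  (bs : forall i, smooth_on (box J) (b i))
  (b0 : forall i u, box J u -> b i u != 0)
  (phid : forall i x, J i x -> derivable (phi i) x 1)
  (phi0 : forall i x, J i x -> phi i x != 0) i j k u (m := contra_index i j k) :
  box J u ->
  contra_christoffel (diag_metric phi) i j k u =
  contra_coef i j k u * phi m (u 0 m) + contra_dcoef i j k u * derive1 (phi m) (u 0 m).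
Proof.
move=> Uu; rewrite contra_christoffelE {}/m /contra_index /contra_coef /contra_dcoef.
have b0' i' : b i' u != 0 by exact: b0.
have p0' i' : phi i' (u 0 i') != 0 by apply: phi0; exact: Uu.
have := p0' i; have := p0' j; have := b0' i; have := b0' j; have := eps1 i; have := eps1 j.
have [<-{j}|ij] := eqVneq i j.
  have [<-{k}|ik] := eqVneq i k.
    rewrite (christoffel_diag Jo eps1 bs b0 phid phi0)// /dlog /=.
    generalize (phi i (u 0 i)) (b i u) (eps i) (pd i (b i) u) (derive1 (phi i) (u 0 i)).
    by move=> p c e dc dp _ _ c0 _ p0 _; field; do ?[apply/andP; split].
  rewrite (christoffel_mixed Jo eps1 bs b0 phid phi0)//=.
  generalize (phi i (u 0 i)) (b i u) (eps i) (pd k (b i) u) (derive1 (phi i) (u 0 i)).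
  by move=> p c e dc dp _ _ c0 _ p0 _; field; do ?[apply/andP; split].
have ji : j != i by rewrite eq_sym.
have [<-{k}|ik] := eqVneq i k.
  rewrite (christoffel_off Jo eps1 bs b0 phid phi0)// /rotation /=.
  generalize (phi i (u 0 i)) (b i u) (eps i) (pd j (b i) u) (derive1 (phi j) (u 0 j)).
  generalize (phi j (u 0 j)) (b j u) (eps j).
  move=> p' c' e' p c e dc dp ee' ee c'0 c0 p'0 p0.
  transitivity (- e' * dc / (c * c' ^+ 2) * p' * (e * e)); last by rewrite ee; ring.
  by field; do ?[apply/andP; split].
have -> : k = j by case: (I2_other k ij) => // ki; move: ik; rewrite ki eqxx.
rewrite (christoffel_sym Jo eps1 bs b0 phid phi0)//.
rewrite (christoffel_mixed Jo eps1 bs b0 phid phi0)//=.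
generalize (phi i (u 0 i)) (b i u) (eps i) (pd i (b j) u) (derive1 (phi i) (u 0 i)).
generalize (phi j (u 0 j)) (b j u) (eps j).
move=> p' c' e' p c e dc dp ee' ee c'0 c0 p'0 p0.
by field; do ?[apply/andP; split].
Qed.

End DiagonalMetric.

(** * The pencil *)

Section Pencil.
Context {R : realType}.
Variables (I : 'I_2 -> set R) (eps : 'I_2 -> R) (b : 'I_2 -> 'rV[R]_2 -> R).
Variable f : 'I_2 -> R -> R.
Hypothesis Io : forall i, open (I i).
Hypothesis eps1 : forall i, eps i * eps i = 1.
Hypothesis bs : forall i, smooth_on (box I) (b i).
Hypothesis b0 : forall i u, box I u -> b i u != 0.
Hypothesis fs : forall i, smooth1_on (I i) (f i).
Hypothesis f0 : forall i x, I i x -> f i x != 0.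
Implicit Types (i j k : 'I_2) (u : 'rV[R]_2) (l : R).

Definition pencil_fun l1 l2 : 'I_2 -> R -> R := fun i x => l1 * f i x + l2.

Lemma is_derive_pencil_fun l1 l2 i x : I i x ->
  is_derive x 1 (pencil_fun l1 l2 i) (l1 * derive1 (f i) x).
Proof.
move=> Ix; have df : is_derive x 1 (f i) (derive1 (f i) x).
  by apply: DeriveDef; [exact: (@fs i 0%N x Ix)|rewrite derive1E].
have := is_deriveD (is_deriveZ l1 df) (is_derive_cst l2 x (1 : R)).
by rewrite addr0.
Qed.

Lemma derive1_pencil_fun l1 l2 i x : I i x ->
  derive1 (pencil_fun l1 l2 i) x = l1 * derive1 (f i) x.
Proof. by rewrite derive1E => /(is_derive_pencil_fun l1 l2)[]. Qed.

Lemma pencilE l1 l2 :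
  pencil (diag_metric eps b f) (diag_metric eps b (fun=> cst 1)) l1 l2
  = diag_metric eps b (pencil_fun l1 l2).
Proof.
apply/funext => u; apply/matrixP => i j; rewrite !mxE.
rewrite /pencil_fun /=; case: (i == j); rewrite ?mulr1n ?mulr0n; last first.
  by rewrite !mulr0 addr0.
by ring.
Qed.

(** Both metrics are members of the family [pencil_fun], so its regularity
    properties cover them as well. *)
Lemma pencil_fun01 : pencil_fun 0 1 = fun=> cst 1.
Proof. by apply/funext => i; apply/funext => x; rewrite /pencil_fun mul0r add0r. Qed.

Lemma pencil_fun10 : pencil_fun 1 0 = f.
Proof. by apply/funext => i; apply/funext => x; rewrite /pencil_fun mul1r addr0. Qed.

(** The reason why flatness of the two metrics propagates to the pencil. *)
Lemma flatness_pencil l1 l2 i j u : box I u ->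
  flatness eps b (pencil_fun l1 l2) i j u =
  l1 * flatness eps b f i j u + l2 * flatness eps b (fun=> cst 1) i j u.
Proof.
move=> Uu; rewrite -pencil_fun01 /flatness !derive1_pencil_fun; do ?exact: Uu.
rewrite /pencil_fun.
generalize (pd i (rotation b i j) u) (pd j (rotation b j i) u) (rotation b i j u)
  (rotation b j i u).
generalize (derive1 (f i) (u 0 i)) (derive1 (f j) (u 0 j)).
by generalize (f i (u 0 i)) (f j (u 0 j)) => p q dp dq dr ds r s; field.
Qed.

(** Sides of the box on which a member of the pencil is a metric. *)
Definition nondeg l1 l2 : 'I_2 -> set R :=
  fun i => [set x | I i x /\ pencil_fun l1 l2 i x != 0].

Lemma nondeg_sub l1 l2 : box (nondeg l1 l2) `<=` box I.
Proof. by move=> u Vu i; have [] := Vu i. Qed.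

Lemma nondeg_open l1 l2 i : open (nondeg l1 l2 i).
Proof.
rewrite openE => x [Ix px]; rewrite /interior.
have nI : \forall y \near x, I i y by exact: open_nbhs_nbhs.
have np : \forall y \near x, pencil_fun l1 l2 i y != 0.
  have [d _] := is_derive_pencil_fun l1 l2 Ix.
  have c : {for x, continuous (pencil_fun l1 l2 i)}.
    exact/differentiable_continuous/derivable1_diffP.
  by apply: (c [set y | y != 0]); apply: open_nbhs_nbhs; split=> //; exact: open_neq.
by apply: filterS2 nI np.
Qed.

(** The determinant is a product of factors depending on one coordinate each, so
    the nondegeneracy domain of a member of the pencil is again a box, and
    [flat_metric_diag] applies on it. *)
Lemma nondegE l1 l2 :
  [set u | box I u /\
    \det (pencil (diag_metric eps b f) (diag_metric eps b (fun=> cst 1)) l1 l2 u) != 0]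
  = box (nondeg l1 l2).
Proof.
rewrite pencilE; apply/seteqP; split=> u.
  move=> [Uu]; rewrite det_metric prodf_seq_neq0 => /allP /= nz i; split; first exact: Uu.
  have := nz i (mem_index_enum _); apply: contra => /eqP ->.
  by rewrite mulr0 mul0r.
move=> Vu; have Uu := nondeg_sub Vu; split=> //=.
rewrite det_metric prodf_seq_neq0; apply/allP => i _ /=.
have ei : eps i != 0.
  by apply/eqP => e; have /eqP := eps1 i; rewrite e mul0r eq_sym oner_eq0.
have [_ pi] := Vu i.
by rewrite !mulf_neq0 ?invr_eq0 ?expf_neq0 ?b0.
Qed.

Lemma pencil_smooth l1 l2 i : smooth_on (box I) (fun u => pencil_fun l1 l2 i (u 0 i)).
Proof.
move=> k; have Uo := open_box Io; apply: CkD => //; last exact: Ck_cst.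
apply: CkM => //; first exact: Ck_cst.
by apply: Ck_coord (@fs i) => // u; exact.
Qed.

Lemma flat_pencil_diag :
  flat_pencil_on (box I) (diag_metric eps b f) (diag_metric eps b (fun=> cst 1)) <->
  forall u, box I u -> flatness eps b f i1 i2 u = 0 /\
                       flatness eps b (fun=> cst 1) i1 i2 u = 0.
Proof.
have sm := pencil_smooth.
have dpencil l1 l2 i x : I i x -> derivable (pencil_fun l1 l2 i) x 1.
  by move=> /(is_derive_pencil_fun l1 l2)[].
have flat1 : flat_metric_on (box I) (diag_metric eps b f) <->
    forall u, box I u -> flatness eps b f i1 i2 u = 0.
  rewrite -pencil_fun10; apply: flat_metric_diag => //; first exact: dpencil.
  by move=> i x Ix; rewrite pencil_fun10; exact: f0.
have flat2 : flat_metric_on (box I) (diag_metric eps b (fun=> cst 1)) <->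
    forall u, box I u -> flatness eps b (fun=> cst 1) i1 i2 u = 0.
  rewrite -pencil_fun01; apply: flat_metric_diag => //; first exact: dpencil.
  by move=> i x Ix; rewrite pencil_fun01; exact: oner_neq0.
split=> [[/flat1 F1 /flat2 F2 _] u Uu|F12]; first by split; [exact: F1|exact: F2].
split; [by apply/flat1 => u /F12[]|by apply/flat2 => u /F12[]|].
move=> l1 l2 _ V; have VE : V = box (nondeg l1 l2) := nondegE l1 l2.
have Vs := @nondeg_sub l1 l2.
have Vo : forall i, open (nondeg l1 l2 i) by exact: nondeg_open.
have bsV i : smooth_on (box (nondeg l1 l2)) (b i).
  by move=> k; apply: Ck_sub (bs i k).
have b0V i u : box (nondeg l1 l2) u -> b i u != 0 by move=> /Vs; exact: b0.
have pdV i x : nondeg l1 l2 i x -> derivable (pencil_fun l1 l2 i) x 1.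
  by move=> [/dpencil].
have p0V i x : nondeg l1 l2 i x -> pencil_fun l1 l2 i x != 0 by move=> [].
rewrite VE pencilE; split.
  apply/flat_metric_diag => //; first by move=> i k; apply: Ck_sub (sm l1 l2 i k).
  move=> u /Vs Uu; rewrite flatness_pencil//.
  by have [-> ->] := F12 _ Uu; rewrite !mulr0 addr0.
move=> i j k u Vu; have Uu := Vs _ Vu; have Um m : I m (u 0 m) by exact: Uu.
have cst0 (m : 'I_2) (x : R) : (cst 1 : R -> R) x != 0 by exact: oner_neq0.
rewrite (contra_christoffel_linear Vo eps1 bsV b0V pdV p0V)//.
rewrite (contra_christoffel_linear Io eps1 bs b0 (fun i x Ix => @fs i 0%N x Ix) f0)//.
rewrite (@contra_christoffel_linear _ _ _ _ (fun=> cst 1) Io eps1 bs b0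
  (fun i x _ => derivable_cst _ _ _) (fun i x _ => cst0 i x))//.
rewrite derive1_pencil_fun// derive1_cst /pencil_fun.
by rewrite /=; ring.
Qed.

End Pencil.

Theorem theorem5p1 (R : realType) (I : 'I_2 -> set R)
    (I_open : forall i, open (I i)) (I_itv : forall i, is_interval (I i))
    (eps : 'I_2 -> R) (eps_pm1 : forall i, eps i = 1 \/ eps i = -1)
    (b : 'I_2 -> 'rV[R]_2 -> R)
    (b_smooth : forall i, smooth_on (box I) (b i))
    (b_neq0 : forall i u, box I u -> b i u != 0)
    (f : 'I_2 -> R -> R)
    (f_smooth : forall i, smooth1_on (I i) (f i))
    (f_neq0 : forall i x, I i x -> f i x != 0) :
  let g2 : 'rV[R]_2 -> 'M[R]_2 :=
    fun u => diag_mx (\row_i (eps i / b i u ^+ 2)) in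
  let g1 : 'rV[R]_2 -> 'M[R]_2 :=
    fun u => diag_mx (\row_i (eps i * f i (u 0 i) / b i u ^+ 2)) in
  flat_pencil_on (box I) g1 g2 <->
  exists F : 'rV[R]_2 -> R,
    [/\ smooth_on (box I) F,
        (forall u, box I u ->
           2 * pd i1 (pd i2 F) u * (f i1 (u 0 i1) - f i2 (u 0 i2))
           + pd i2 F u * derive1 (f i1) (u 0 i1)
           - pd i1 F u * derive1 (f i2) (u 0 i2) = 0) &
        (forall u, box I u ->
           pd i1 (b i2) u = eps i1 * pd i2 F u * b i1 u /\
           pd i2 (b i1) u = - eps i2 * pd i1 F u * b i2 u)].
Proof.
move=> g2 g1; have Uo := open_box I_open.
have eps1 i : eps i * eps i = 1 by case: (eps_pm1 i) => ->; ring.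
have -> : g2 = diag_metric eps b (fun=> cst 1).
  by apply/funext => u; congr diag_mx; apply/rowP => i; rewrite !mxE mulr1.
have rotation_smooth i j : smooth_on (box I) (rotation b i j).
  move=> k; apply: CkM => //; first by apply: smooth_pd.
  by apply: CkV; [|move=> u; exact: b_neq0|exact: b_smooth].
apply: iff_trans (flat_pencil_diag I_open eps1 b_smooth b_neq0 f_smooth f_neq0) _.
have flatE u : flatness eps b (fun=> cst 1) i1 i2 u =
    eps i1 * pd i1 (rotation b i1 i2) u + eps i2 * pd i2 (rotation b i2 i1) u.
  by rewrite /flatness !derive1_cst /= !mul1r !mul0r !addr0.
split=> [flat|[F [Fs eqF sysF]] u Uu].
  pose P u := - eps i2 * rotation b i2 i1 u; pose Q u := eps i1 * rotation b i1 i2 u.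
  have Ps : smooth_on (box I) P by exact: smoothZ.
  have Qs : smooth_on (box I) Q by exact: smoothZ.
  have pdP u : box I u -> pd i2 P u = - eps i2 * pd i2 (rotation b i2 i1) u by exact: pdZ.
  have pdQ u : box I u -> pd i1 Q u = eps i1 * pd i1 (rotation b i1 i2) u by exact: pdZ.
  have [u Uu|F [Fs FP FQ]] := poincare I_open I_itv Ps Qs.
    rewrite pdP// pdQ// mulNr; apply/esym/eqP; rewrite -addr_eq0 -flatE.
    by have [_ ->] := flat _ Uu.
  exists F; split=> // u Uu.
    rewrite (pd_open i1 Uo FQ Uu) pdQ// FP// FQ// /P /Q.
    have [] := flat _ Uu; rewrite flatE /flatness.
    generalize (pd i1 (rotation b i1 i2) u) (pd i2 (rotation b i2 i1) u).
    generalize (rotation b i1 i2 u) (rotation b i2 i1 u).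
    generalize (derive1 (f i1) (u 0 i1)) (derive1 (f i2) (u 0 i2)).
    generalize (f i1 (u 0 i1)) (f i2 (u 0 i2)) (eps i1) (eps i2).
    move=> p q e e' dp dq r s dr ds H1 H2.
    (* Twice the flatness of g1, minus 2 f^2 times that of g2. *)
    transitivity (2 * (e * (p * dr + dp / 2 * r) + e' * (q * ds + dq / 2 * s))
      - 2 * q * (e * dr + e' * ds)); first by field.
    by rewrite H1 H2; ring.
  rewrite FP// FQ// /P /Q !mulrA mulrNN !eps1 !mul1r.
  by split; [exact: (pd_rotation b_neq0 i1 i2 Uu)|exact: (pd_rotation b_neq0 i2 i1 Uu)].
have rot12 v : box I v -> rotation b i1 i2 v = eps i1 * pd i2 F v.
  by move=> Uv; rewrite /rotation; have [-> _] := sysF _ Uv; rewrite mulfK ?b_neq0.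
have rot21 v : box I v -> rotation b i2 i1 v = - eps i2 * pd i1 F v.
  by move=> Uv; rewrite /rotation; have [_ ->] := sysF _ Uv; rewrite mulfK ?b_neq0.
have d12 : pd i1 (rotation b i1 i2) u = eps i1 * pd i1 (pd i2 F) u.
  by rewrite (pd_open i1 Uo rot12 Uu); apply: pdZ Uu; exact: smooth_pd.
have d21 : pd i2 (rotation b i2 i1) u = - eps i2 * pd i1 (pd i2 F) u.
  rewrite (pd_open i2 Uo rot21 Uu) (pd_comm Uo Fs Uu).
  by apply: pdZ Uu; exact: smooth_pd.
have := eqF _ Uu; rewrite flatE /flatness d12 d21 (rot12 _ Uu) (rot21 _ Uu).
have := eps1 i1; have := eps1 i2.
generalize (pd i1 (pd i2 F) u) (pd i1 F u) (pd i2 F u).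
generalize (derive1 (f i1) (u 0 i1)) (derive1 (f i2) (u 0 i2)).
generalize (f i1 (u 0 i1)) (f i2 (u 0 i2)) (eps i1) (eps i2).
move=> p q e e' dp dq d d1 d2 ee' ee H; split.
  (* Half the equation for F; the signs eps_i enter only through their squares. *)
  transitivity (((e * e) * (2 * d * p + d2 * dp) - (e' * e') * (2 * d * q + d1 * dq)) / 2).
    by field.
  rewrite ee ee' !mul1r -[RHS](mul0r 2^-1); congr (_ / _); rewrite -H; ring.
transitivity ((e * e - e' * e') * d); first by ring.
by rewrite ee ee' subrr mul0r.
Qed.
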